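(* Let $N^{+}(s)$ be the number of eigenvalues, counted with multiplicity, in $(0,s]$ of the operator $L_1=\left(\frac{\partial}{\partial t}\right)^4+\Delta_x$ on $S^1\times S^2$; that is, $$N^{+}(s)=\sum_{\substack{j\in\mathbb{Z},\ k\in\mathbb{Z}_{\ge 0}\\ 0<j^4-k(k+1)\le s}}(2k+1).$$ Then for all sufficiently large $s$, $$\frac{4}{3}s^{3/2}\le N^{+}(s)\le\frac{8}{3}s^{3/2}.$$
   Context: $S^1=\mathbb{R}/2\pi\mathbb{Z}$, $S^2$ is the standard unit sphere, and $\Delta_x$ is the (nonpositive) Laplacian on $S^2$. The eigenfunctions of $L_1$ are $e^{ijt}Y_k(x)$ with $j\in\mathbb{Z}$ and $Y_k$ a spherical harmonic of degree $k\ge 0$; the eigenvalue is $j^4-k(k+1)$, and for each pair $(j,k)$ the corresponding space has dimension $2k+1$. *)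

(* Defs.v *)
From HB Require Import structures.
From mathcomp Require Import all_boot all_order all_algebra.
From mathcomp Require Import all_classical all_reals all_analysis.

Set Implicit Arguments.
Unset Strict Implicit.
Unset Printing Implicit Defensive.

Import Order.TTheory GRing.Theory Num.Theory.

Local Open Scope ring_scope.
Local Open Scope classical_set_scope.

(** Spectrum of [L_1 = (d/dt)^4 + Delta_x] on [S^1 x S^2]: the function
    [e^{ijt} Y_k(x)], with [j : int] and [Y_k] a spherical harmonic of degree
    [k : nat], has eigenvalue [j^4 - k(k+1)], because
    [Delta_x Y_k = - k(k+1) Y_k]. *)
Definition L1_eigenvalue (j : int) (k : nat) : int :=
  j ^+ 4 - (k * k.+1)%N%:Z.

(** Dimension of the space spanned by the [e^{ijt} Y_k] for fixed [(j, k)]. *)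
Definition L1_multiplicity (k : nat) : nat := (2 * k + 1)%N.

(** The sum is taken in the extended reals: it would be [+oo] if infinitely
    many pairs [(j, k)] contributed. *)
Definition Nplus (R : realType) (s : R) : \bar R :=
  \esum_(p in [set p : int * nat |
                 0 < (L1_eigenvalue p.1 p.2)%:~R :> R /\
                 (L1_eigenvalue p.1 p.2)%:~R <= s])
    ((L1_multiplicity p.2)%:R)%:E.

(* Main.v *)
Require Import Defs.
From HB Require Import structures.
From mathcomp Require Import all_boot all_order all_algebra.
From mathcomp Require Import all_classical all_reals all_analysis.
From mathcomp Require Import zify lra.

Set Implicit Arguments.
Unset Strict Implicit.
Unset Printing Implicit Defensive.

Import Order.TTheory GRing.Theory Num.Theory.
Import numFieldNormedType.Exports.

Local Open Scope ring_scope.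
Local Open Scope classical_set_scope.

(** Fix [a = |j| >= 1] and write [b = a^2]. Since [(b - 1) b < b^2 < b (b + 1)],
    the eigenvalue [a^4 - k (k + 1)] is positive exactly for [k < b], so [j]
    contributes to the count, for an integer bound [n], the [shell] below: the
    multiplicities [2k + 1] over [k < b] with [a^4 <= k (k + 1) + n].

    Summation of [2k + 1] over a window [K <= k < b] gives [b^2 - K^2], and the
    cut-off [K (K + 1) >= b^2 - n] turns this into at most [n + K <= n + a^2]
    ([shell_le]). From below, the top degrees alone give [2 a^2 - 1] as soon as
    [a^2 <= n] (degree [b - 1], [shell_ge1]) and [4 a^2 - 4] as soon as
    [3 a^2 <= n] (degrees [b - 1] and [b - 2], [shell_ge2]). No frequency with
    [a^2 > n] contributes.

    Let [x = sqrt s], [m] the integer part of [x] and [n] that of [s]. The sum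
    over [1 <= a <= m], doubled to account for [j = a] and [j = -a], is then to
    leading order at most [2 (x^3 + x^3 / 3) = 8/3 x^3], and the one-degree lower
    bound alone gives [2 * (2/3 x^3) = 4/3 x^3]. The lower order terms decide in
    both cases. Above, the excess is about [s] in total, and it is compensated
    by the single frequency [a = 1], whose shell is at most [1] instead of
    [n + 1] ([sum_shell_le]). Below, replacing [x] by its integer part loses
    [O(s)], and it is compensated by a cubic gain from the second degree for
    [a <= m / 2] ([sum_shell_ge]). *)

Definition shell (n a : nat) : nat :=
  (\sum_(0 <= k < a ^ 2 | a ^ 4 <= k * k.+1 + n) L1_multiplicity k)%N.

(** Truncated subtraction makes the induction on [b] go through without naming
    the cut-off degree: while [k (k + 1) + n < A] both sides are zero, and
    afterwards the right-hand side grows by [2b + 2 >= 2b + 1] at each step. *)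
Lemma sum_multiplicity_window_le (A n b : nat) :
  (\sum_(0 <= k < b | A <= k * k.+1 + n) L1_multiplicity k
     <= b * b.+1 + n - A)%N.
Proof.
elim: b => [|b IH]; first by rewrite big_geq.
rewrite big_mkcond big_nat_recr //= -big_mkcond /=.
move: IH; set g := bigop _ _ _ => IH.
by case: ifP; rewrite /L1_multiplicity; nia.
Qed.

Lemma shell_le (n a : nat) : (shell n a <= a ^ 2 + n)%N.
Proof.
apply: leq_trans (sum_multiplicity_window_le (a ^ 4) n (a ^ 2)) _.
by rewrite (expnD a 2 2); nia.
Qed.

Lemma shell1_le (n : nat) : (shell n 1 <= 1)%N.
Proof. by rewrite /shell big_mkcond big_nat1 /=; case: ifP. Qed.

(** Degree [a^2 - 1] alone: its eigenvalue is [a^4 - (a^2 - 1) a^2 = a^2]. *)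
Lemma shell_ge1 (n a : nat) : (0 < a)%N -> (a ^ 2 <= n)%N ->
  (2 * a ^ 2 <= shell n a + 1)%N.
Proof.
rewrite /shell (expnD a 2 2) => a0 an.
have : (0 < a ^ 2)%N by rewrite expn_gt0 a0.
move: an; move: (a ^ 2)%N => [//|b] an _.
rewrite big_mkcond big_nat_recr //= ifT; last by nia.
by rewrite /L1_multiplicity; lia.
Qed.

(** Degrees [a^2 - 1] and [a^2 - 2], of eigenvalues [a^2] and [3 a^2 - 2]. *)
Lemma shell_ge2 (n a : nat) : (0 < a)%N -> (3 * a ^ 2 <= n)%N ->
  (4 * a ^ 2 <= shell n a + 4)%N.
Proof.
rewrite /shell (expnD a 2 2) => a0 an.
have : (0 < a ^ 2)%N by rewrite expn_gt0 a0.
move: an; move: (a ^ 2)%N => [//|[|b]] an _; first by lia.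
rewrite big_mkcond !big_nat_recr //= !ifT; [|by nia|by nia].
by rewrite /L1_multiplicity; lia.
Qed.

Lemma sum_squares (m : nat) :
  (6 * \sum_(1 <= a < m.+1) a ^ 2 = m * m.+1 * (2 * m).+1)%N.
Proof.
elim: m => [|m IH]; first by rewrite big_geq.
by rewrite big_nat_recr //= mulnDr IH; nia.
Qed.

(** Bounding every shell by [n + a^2] would leave the excess
    [m^2 / 2 + m / 6 <= n] over [m n + m^3 / 3]; bounding the shell of [1] by
    [1] rather than [n + 1] saves [n]. *)
Lemma sum_shell_le (n m : nat) : (0 < m)%N -> (m ^ 2 <= n)%N ->
  (3 * \sum_(1 <= a < m.+1) shell n a <= 3 * m * n + m ^ 3)%N.
Proof.
move=> m0 mn.
have : (\sum_(1 <= a < m.+1) shell n a + n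
        <= \sum_(1 <= a < m.+1) (a ^ 2 + n))%N.
  rewrite big_ltn // [leqRHS]big_ltn //.
  have : (\sum_(2 <= a < m.+1) shell n a <= \sum_(2 <= a < m.+1) (a ^ 2 + n))%N.
    by apply: leq_sum => a _; exact: shell_le.
  by have := shell1_le n; lia.
rewrite big_split /= sum_nat_const_nat subn1 /=.
by have := sum_squares m; nia.
Qed.

(** The left-hand side has [m + 1] because [sqrt s] is only known to be below
    [m + 1]. The first-degree bound yields [2 m^3 + 3 m^2 + O(m)], short of
    [2 (m + 1)^3] by about [3 m^2]; the second degree, available for [a <= m / 2],
    adds about [m^3 / 4], which is enough from [m = 17] on. *)
Lemma sum_shell_ge (n m : nat) : (17 <= m)%N -> (m ^ 2 <= n)%N ->
  (2 * m.+1 ^ 3 <= 3 * \sum_(1 <= a < m.+1) shell n a)%N.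
Proof.
move=> m17 mn.
pose h := m./2.
have hm : (h <= m)%N by rewrite /h; lia.
have pointwise a : (1 <= a < m.+1)%N ->
    (2 * a ^ 2 + (if (a < h.+1)%N then 2 * a ^ 2 else 0)
      <= shell n a + 1 + (if (a < h.+1)%N then 3 else 0))%N.
  move=> /andP[a0 am].
  have a2m : (a ^ 2 <= m ^ 2)%N by rewrite leq_exp2r.
  case: ifP => ah; last by rewrite !addn0 shell_ge1 // (leq_trans a2m).
  (* [a <= m / 2] gives [4 a^2 <= m^2 <= n], more than [shell_ge2] asks for. *)
  have : (2 * a <= m)%N by move: ah; rewrite /h; lia.
  have := @shell_ge2 n a a0; nia.
have : (\sum_(1 <= a < m.+1)
          (2 * a ^ 2 + (if (a < h.+1)%N then 2 * a ^ 2 else 0))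
        <= \sum_(1 <= a < m.+1)
             (shell n a + 1 + (if (a < h.+1)%N then 3 else 0)))%N.
  rewrite big_nat_cond [leqRHS]big_nat_cond.
  by apply: leq_sum => a /andP[/pointwise].
have restrict F : (\sum_(1 <= a < m.+1) (if (a < h.+1)%N then F a else 0)
                   = \sum_(1 <= a < h.+1) F a)%N.
  by rewrite -big_mkcond [RHS](@big_nat_widen _ _ _ _ _ m.+1).
rewrite !big_split /= !restrict -!big_distrr /= !sum_nat_const_nat !subn1 /=.
have := sum_squares m; have := sum_squares h.
have : (m <= 2 * h + 1)%N by rewrite /h; lia.
have : (8 <= h)%N by rewrite /h; lia.
move: (bigop _ _ _) (bigop _ _ _) (bigop _ _ _) => S1 S2 S3.
nia.
Qed.

Definition frequencies (m : nat) : seq int :=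
  [seq Posz a | a <- index_iota 1 m.+1] ++
  [seq - Posz a | a <- index_iota 1 m.+1].

Lemma mem_frequencies (m : nat) (j : int) :
  (j \in frequencies m) = (0 < `|j| < m.+1)%N.
Proof.
rewrite mem_cat; apply/orP/idP.
  by case=> /mapP[a]; rewrite mem_index_iota => + ->; rewrite ?abszN absz_nat.
move=> jm; have [j0|j0] := leP 0 j; [left|right];
  by apply/mapP; exists `|j|%N; rewrite ?mem_index_iota //; lia.
Qed.

Lemma uniq_frequencies (m : nat) : uniq (frequencies m).
Proof.
rewrite cat_uniq !map_inj_uniq ?iota_uniq; last 2 first.
- by move=> a b /oppr_inj[].
- by move=> a b [].
rewrite andbT; apply/hasPn => j /mapP[a]; rewrite mem_index_iota => a1 ->.
by apply/mapP => -[b]; rewrite mem_index_iota; lia.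
Qed.

Definition eigenpairs (n m : nat) : seq (int * nat) :=
  [seq (j, k) | j <- frequencies m,
     k <- [seq k <- index_iota 0 (`|j| ^ 2) | (`|j| ^ 4 <= k * k.+1 + n)%N]].

Lemma uniq_eigenpairs (n m : nat) : uniq (eigenpairs n m).
Proof.
apply: allpairs_uniq_dep; first exact: uniq_frequencies.
  by move=> j _; rewrite filter_uniq // iota_uniq.
by move=> [j k] [j' k'] _ _ /= [-> ->].
Qed.

(** Eigenvalues are integers, so the bound [s] may be replaced by its integer
    part [n]. A pair in the spectral set has [k < j^2], hence
    [n >= j^4 - k (k + 1) >= j^2], which bounds [|j|] by [m]: the listed pairs
    exhaust the set. *)
Lemma mem_eigenpairs (R : realType) (s : R) (m : nat) : 0 <= s ->
  (Num.truncn s < m.+1 ^ 2)%N ->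
  [set` eigenpairs (Num.truncn s) m] =
    [set p : int * nat | 0 < (L1_eigenvalue p.1 p.2)%:~R :> R /\
                         (L1_eigenvalue p.1 p.2)%:~R <= s].
Proof.
move=> s0 nm; apply/seteqP.
have E j k : 0 < (L1_eigenvalue j k)%:~R :> R /\ (L1_eigenvalue j k)%:~R <= s <->
    (k * k.+1 < `|j| ^ 4 <= k * k.+1 + Num.truncn s)%N.
  have jE : j ^+ 4 = (`|j| ^ 4)%N%:Z.
    by rewrite -natz natrX natz abszE -normrX ger0_norm // (exprM j 2 2) sqr_ge0.
  rewrite ltr0z /L1_eigenvalue jE subr_gt0 ltz_nat.
  have [kj|] /= := ltnP; last by split => // -[].
  rewrite subzn; last exact: ltnW.
  rewrite -pmulrn -truncn_ge_nat //.
  by rewrite leq_subLR; split => // -[].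
split=> [[j k] /allpairsPdep[j' [k' []]]|[j k] /E/andP[/= kj jk]] /=.
  rewrite mem_frequencies mem_filter mem_index_iota.
  move=> j0m /andP[jk kj] [-> ->]; apply/E; rewrite jk andbT.
  by rewrite (expnD `|j'| 2 2); move: (`|j'| ^ 2)%N kj => b; nia.
apply/allpairsPdep; exists j, k.
rewrite mem_frequencies mem_filter jk mem_index_iota /=.
move: kj jk; rewrite (expnD `|j| 2 2) => kj jk.
have kj2 : (k < `|j| ^ 2)%N by move: (`|j| ^ 2)%N kj => b; nia.
split=> //; apply/andP; split.
  by case: `|j|%N kj2.
rewrite -(@ltn_exp2r _ _ 2) //; apply: leq_ltn_trans nm.
by move: (`|j| ^ 2)%N kj2 jk => b; nia.
Qed.

Lemma Nplus_shells (R : realType) (s : R) (m : nat) : 0 <= s ->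
  (Num.truncn s < m.+1 ^ 2)%N ->
  Nplus s = ((2 * \sum_(1 <= a < m.+1) shell (Num.truncn s) a)%N%:R)%:E.
Proof.
move=> s0 nm; rewrite /Nplus -(mem_eigenpairs s0 nm).
rewrite esum_fset; last 2 first.
- exact: finite_seq.
- by move=> i _; rewrite lee_fin.
rewrite -fsbig_seq ?uniq_eigenpairs // sumEFin -natr_sum; congr (_%:R%:E).
rewrite big_allpairs_dep /= big_cat /= !big_map mul2n -addnn.
by congr addn; apply: eq_bigr => a _; rewrite ?abszN absz_nat big_filter.
Qed.

Theorem theorem6p2 (R : realType) :
  \forall s \near (+oo : set_system R),
    ((4 / 3 * s `^ (3 / 2))%:E <= Nplus s)%E /\
    (Nplus s <= (8 / 3 * s `^ (3 / 2))%:E)%E.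
Proof.
near=> s.
have s_ge : 17 ^+ 2 <= s by near: s; apply: nbhs_pinfty_ge; rewrite num_real.
have s0 : 0 <= s by apply: le_trans s_ge; rewrite exprn_ge0.
set x := Num.sqrt s.
have x0 : 0 <= x by exact: sqrtr_ge0.
have sx : s = x ^+ 2 by rewrite sqr_sqrtr.
have -> : s `^ (3 / 2) = x ^+ 3.
  by rewrite (mulrC 3) powRrM powR12_sqrt // powR_mulrn.
set m := Num.truncn x; set n := Num.truncn s.
have /andP[mx xm] : m%:R <= x < m.+1%:R by exact: truncn_itv.
have /andP[ns _] : n%:R <= s < n.+1%:R by exact: truncn_itv.
have mn : (m ^ 2 <= n)%N.
  by rewrite truncn_ge_nat // natrX sx ler_sqr ?nnegrE.
have nm : (n < m.+1 ^ 2)%N.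
  rewrite -(ltr_nat R) natrX (le_lt_trans ns) // sx ltr_sqr ?nnegrE //.
have m17 : (17 <= m)%N.
  by rewrite truncn_ge_nat // -ler_sqr ?nnegrE // -sx.
rewrite (Nplus_shells s0 nm) !lee_fin -/n natrM.
have m0 : (0 < m)%N by exact: leq_trans m17.
have := sum_shell_ge m17 mn; have := sum_shell_le m0 mn.
rewrite -!(ler_nat R) !(natrX, natrD, natrM).
set T := (bigop _ _ _)%:R => Tle Tge.
have x3m : x ^+ 3 <= m.+1%:R ^+ 3 by rewrite lerXn2r ?nnegrE // ltW.
have m3x : m%:R ^+ 3 <= x ^+ 3 by rewrite lerXn2r ?nnegrE.
have mnx : m%:R * n%:R <= x ^+ 3 by rewrite (exprS x 2) ler_pM // -sx.
by split; lra.
Unshelve. all: by end_near.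
Qed.
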